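(* Let $\mathsf G,c>0$, $M\in\mathbb R$, $Q\in\mathbb R\setminus\{0\}$ with $\frac{\mathsf GM^2}{Q^2}<1$ (superextremal case), and consider the Reissner--Weyl--Nordström metric $$ds_{\mathbf g}^2=-e^{2\alpha(r)}c^2dt^2+e^{-2\alpha(r)}dr^2+r^2(d\vartheta^2+\sin^2\vartheta\,d\varphi^2),\qquad e^{2\alpha(r)}=1-\frac{2\mathsf GM}{c^2r}+\frac{\mathsf GQ^2}{c^4r^2},$$ for $t\in\mathbb R$, $r\in(0,\infty)$. Then the twice-contracted second Bianchi identity does not hold weakly for this spacetime. In fact, not even the inhomogeneous twice-contracted second Bianchi identity holds weakly.
   Context: Spatially conformally flat coordinates: put $A=\frac{\mathsf GM}{c^2}$, $B=\frac{\sqrt{\mathsf G}|Q|}{c^2}$, $\rho_0=B-A>0$ and $\rho(r)=(r-A)+\sqrt{(r-A)^2+(B^2-A^2)}$. In coordinates $(t,\rho,\vartheta,\varphi)$, $\rho\in(\rho_0,\infty)$, the metric is $-e^{2\gamma(\rho)}c^2dt^2+\phi^4(\rho)[d\rho^2+\rho^2(d\vartheta^2+\sin^2\vartheta\,d\varphi^2)]$ with $\phi^2=r/\rho$ and $\gamma(\rho)=\alpha(r(\rho))$, so the spacetime is $\mathcal M\cong\mathbb R\times(\mathbb R^3\setminus\overline{B_{\rho_0}(0)})$. Put $\overline{\mathcal M}\cong\mathbb R\times(\mathbb R^3\setminus B_{\rho_0}(0))$, and let $\mathfrak X_c(\overline{\mathcal M})$ be the vector fields smooth on $\overline{\mathcal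 M}$ (up to and including the boundary $\rho=\rho_0$, in the coordinates built from $\rho$) with compact support in $\overline{\mathcal M}$. Definition. Let $G^\mu{}_\nu=R^\mu{}_\nu-\frac12R\,\delta^\mu{}_\nu$ be the Einstein tensor of $\mathbf g$. The inhomogeneous twice-contracted second Bianchi identity holds weakly on $\mathcal M$ if for every $\psi\in\mathfrak X_c(\overline{\mathcal M})$ the integral (a) $\int_{\mathcal M}G^\mu{}_\nu\nabla_\mu\psi^\nu\,d\mathrm{vol}_{\mathbf g}$ exists and equals the limit (b) $\lim_{\varepsilon\to0}\int_{\mathcal T_\varepsilon}i_X(d\mathrm{vol}_{\mathbf g})$, where $X^\mu=G^\mu{}_\nu\psi^\nu$, $i_X$ is the interior product, and $\mathcal T_\varepsilon\cong\mathbb R\times\partial B_{\rho_0+\varepsilon}(0)$ is oriented as the boundary of $\mathbb R\times(\mathbb R^3\setminus\overline{B_{\rho_0+\varepsilon}(0)})$. The twice-contracted second Bianchi identity holds weakly if moreover (a) $=$ (b) $=0$ for every such $\psi$. *)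

(* Defs.v *)
From HB Require Import structures.
From mathcomp Require Import all_boot all_order all_algebra.
From mathcomp Require Import all_classical all_reals all_analysis.
From mathcomp Require Import ring lra.
Import Order.TTheory GRing.Theory Num.Theory.
Import numFieldNormedType.Exports.

Set Implicit Arguments.
Unset Strict Implicit.
Unset Printing Implicit Defensive.

Local Open Scope classical_set_scope.
Local Open Scope ring_scope.

(* Points and tangent vectors of R x R^3 are row vectors (t, x_1, x_2, x_3);
   column 0 is the time coordinate. *)

Section smooth_functions.
Context {R : realType}.
Implicit Types (f : 'rV[R]_4 -> R) (A U : set 'rV[R]_4).

Definition partial (i : 'I_4) f (x : 'rV[R]_4) : R := 'D_(delta_mx 0 i) f x.

Definition iter_partial (s : seq 'I_4) f : 'rV[R]_4 -> R := foldr partial f s.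

Definition smooth_on_open U f : Prop :=
  forall (s : seq 'I_4) (x : 'rV[R]_4), U x ->
    {for x, continuous (iter_partial s f)} /\
    forall i, derivable (iter_partial s f) x (delta_mx 0 i).

(* Smoothness on a set that need not be open, in particular up to and
   including a boundary: f extends smoothly near each point of A. *)
Definition smooth_on A f : Prop :=
  forall x, A x -> exists U F,
    [/\ open U, U x, smooth_on_open U F & forall y, U y -> A y -> F y = f y].

(* Only the values of psi on A are relevant. *)
Definition smooth_compactly_supported A (psi : 'rV[R]_4 -> 'rV[R]_4) : Prop :=
  (forall i, smooth_on A (fun x => psi x 0 i)) /\
  compact (closure [set x | A x /\ psi x != 0]).

End smooth_functions.

Section curvature.
Context {R : realType}.
Variable g : 'rV[R]_4 -> 'M[R]_4.
Implicit Types (x : 'rV[R]_4) (X psi : 'rV[R]_4 -> 'rV[R]_4).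

(* christoffel l m n x = Gamma^l_{m n}(x) *)
Definition christoffel (l m n : 'I_4) x : R :=
  2^-1 * \sum_(s < 4) invmx (g x) l s *
    (partial m (fun y => g y s n) x + partial n (fun y => g y s m) x
     - partial s (fun y => g y m n) x).

(* riemann a b m n x = R^a_{b m n}(x) *)
Definition riemann (a b m n : 'I_4) x : R :=
  partial m (christoffel a n b) x - partial n (christoffel a m b) x
  + \sum_(l < 4) (christoffel a m l x * christoffel l n b x
                  - christoffel a n l x * christoffel l m b x).

Definition ricci (b n : 'I_4) x : R := \sum_(a < 4) riemann a b a n x.

(* mixed components R^m_n and G^m_n *)
Definition ricci_mixed (m n : 'I_4) x : R :=
  \sum_(s < 4) invmx (g x) m s * ricci s n x.

Definition scalar_curvature x : R := \sum_(m < 4) ricci_mixed m m x.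

Definition einstein (m n : 'I_4) x : R :=
  ricci_mixed m n x - 2^-1 * scalar_curvature x * (m == n)%:R.

(* covariant_derivative m n psi x = (nabla_m psi^n)(x) *)
Definition covariant_derivative (m n : 'I_4) psi x : R :=
  partial m (fun y => psi y 0 n) x
  + \sum_(s < 4) christoffel n m s x * psi x 0 s.

Definition einstein_contract psi x : 'rV[R]_4 :=
  \row_(m < 4) \sum_(n < 4) einstein m n x * psi x 0 n.

Definition volume_density x : R := Num.sqrt `|\det (g x)|.

(* The volume form, for the orientation dt /\ dx_1 /\ dx_2 /\ dx_3. *)
Definition volume_form x (v0 v1 v2 v3 : 'rV[R]_4) : R :=
  volume_density x * \det (\matrix_(i < 4) nth 0 [:: v0; v1; v2; v3] i).

Definition interior_product X (omega : 'rV[R]_4 ->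
    'rV[R]_4 -> 'rV[R]_4 -> 'rV[R]_4 -> 'rV[R]_4 -> R)
  x (v1 v2 v3 : 'rV[R]_4) : R := omega x (X x) v1 v2 v3.

End curvature.

Section weak_bianchi.
Context {R : realType}.
Let leb := @lebesgue_measure R.

Definition spatial_norm (x : 'rV[R]_4) : R :=
  Num.sqrt (\sum_(i < 3) x 0 (lift ord0 i) ^+ 2).

(* R x (R^3 \ closed ball of radius rho0) and R x (R^3 \ open ball). *)
Definition exterior (rho0 : R) : set 'rV[R]_4 := [set x | rho0 < spatial_norm x].

Definition closed_exterior (rho0 : R) : set 'rV[R]_4 :=
  [set x | rho0 <= spatial_norm x].

Definition point (p : R * R * R * R) : 'rV[R]_4 :=
  \row_(i < 4) nth 0 [:: p.1.1.1; p.1.1.2; p.1.2; p.2] i.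

Definition lebesgue4 := (((leb \x leb) \x leb) \x leb)%E.

Definition lebesgue3 := ((leb \x leb) \x leb)%E.

(* G^m_n nabla_m psi^n sqrt|det g|, the density of (a) with respect to
   dt dx_1 dx_2 dx_3. *)
Definition bulk_density (g : 'rV[R]_4 -> 'M[R]_4)
    (psi : 'rV[R]_4 -> 'rV[R]_4) (x : 'rV[R]_4) : R :=
  (\sum_(m < 4) \sum_(n < 4)
    einstein g m n x * covariant_derivative g m n psi x) * volume_density g x.

Definition bulk_integral_exists (g : 'rV[R]_4 -> 'M[R]_4) (rho0 : R)
    (psi : 'rV[R]_4 -> 'rV[R]_4) : Prop :=
  lebesgue4.-integrable (point @^-1` exterior rho0)
    (EFin \o (bulk_density g psi \o point)).

Definition bulk_integral (g : 'rV[R]_4 -> 'M[R]_4) (rho0 : R)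
    (psi : 'rV[R]_4 -> 'rV[R]_4) : R :=
  Rintegral lebesgue4 (point @^-1` exterior rho0) (bulk_density g psi \o point).

Definition spherical (t rho theta phi : R) : 'rV[R]_4 :=
  point (t, rho * (sin theta * cos phi), rho * (sin theta * sin phi),
         rho * cos theta).

(* The integral of a 3-form over R x (sphere of radius rho), parametrized by
   (t, theta, phi).  Along this tube, (- d_rho, d_t, d_theta, d_phi) is
   positively oriented for dt /\ dx_1 /\ dx_2 /\ dx_3 and - d_rho points out
   of R x (R^3 \ closed ball), so that (t, theta, phi) are positively oriented
   coordinates for the boundary orientation. *)
Definition tube_integral (rho : R)
    (omega : 'rV[R]_4 -> 'rV[R]_4 -> 'rV[R]_4 -> 'rV[R]_4 -> R) : R :=
  Rintegral lebesgue3 (setT `*` `[0, pi] `*` `[0, 2 * pi])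
    (fun q : R * R * R => let: (t, theta, phi) := q in
      omega (spherical t rho theta phi)
        (derive1 (fun s => spherical s rho theta phi) t)
        (derive1 (fun s => spherical t rho s phi) theta)
        (derive1 (fun s => spherical t rho theta s) phi)).

Definition boundary_flux (g : 'rV[R]_4 -> 'M[R]_4) (rho0 : R)
    (psi : 'rV[R]_4 -> 'rV[R]_4) (eps : R) : R :=
  tube_integral (rho0 + eps)
    (interior_product (einstein_contract g psi) (volume_form g)).

Definition inhomogeneous_bianchi_weakly (g : 'rV[R]_4 -> 'M[R]_4) (rho0 : R)
    : Prop :=
  forall psi, smooth_compactly_supported (closed_exterior rho0) psi ->
    bulk_integral_exists g rho0 psi /\
    boundary_flux g rho0 psi eps @[eps --> 0^'+] --> bulk_integral g rho0 psi.

Definition bianchi_weakly (g : 'rV[R]_4 -> 'M[R]_4) (rho0 : R) : Prop :=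
  inhomogeneous_bianchi_weakly g rho0 /\
  forall psi, smooth_compactly_supported (closed_exterior rho0) psi ->
    bulk_integral g rho0 psi = 0 /\
    boundary_flux g rho0 psi eps @[eps --> 0^'+] --> (0 : R).

End weak_bianchi.

Section rwn.
Context {R : realType}.
Variables G c M Q : R.

Definition mass_length : R := G * M / c ^+ 2.

Definition charge_length : R := Num.sqrt G * `|Q| / c ^+ 2.

Local Notation A := mass_length.
Local Notation B := charge_length.

Definition e2alpha (r : R) : R :=
  1 - 2 * G * M / (c ^+ 2 * r) + G * Q ^+ 2 / (c ^+ 4 * r ^+ 2).

Definition inner_radius : R := B - A.

Definition rho_of_r (r : R) : R :=
  (r - A) + Num.sqrt ((r - A) ^+ 2 + (B ^+ 2 - A ^+ 2)).

(* The inverse of rho_of_r : (0, oo) -> (inner_radius, oo);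
   see r_of_rhoK and rho_of_rK. *)
Definition r_of_rho (rho : R) : R :=
  A + (rho - (B ^+ 2 - A ^+ 2) / rho) / 2.

(* phi^2 = r / rho *)
Definition phi2 (rho : R) : R := r_of_rho rho / rho.

(* - e^{2 gamma} c^2 dt^2 + phi^4 (dx_1^2 + dx_2^2 + dx_3^2), the bracket
   d rho^2 + rho^2 (d theta^2 + sin^2 theta d phi^2) being the Euclidean metric
   of R^3 in Cartesian coordinates; see rwn_metric_pullback. *)
Definition rwn_metric (x : 'rV[R]_4) : 'M[R]_4 :=
  diag_mx (\row_(i < 4)
    if i == ord0 then - (e2alpha (r_of_rho (spatial_norm x)) * c ^+ 2)
    else phi2 (spatial_norm x) ^+ 2).

Hypotheses (G0 : 0 < G) (c0 : 0 < c) (Q0 : Q != 0)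
  (superextremal : G * M ^+ 2 / Q ^+ 2 < 1).

Lemma superextremal_lengths : `|A| < B.
Proof.
have c4 : 0 < c ^+ 2 by rewrite exprn_gt0.
have Q2 : 0 < Q ^+ 2 by rewrite exprn_even_gt0.
have B0 : 0 <= B by rewrite /B !mulr_ge0 ?invr_ge0 ?sqrtr_ge0 // ltW.
rewrite -(@ltr_pXn2r _ 2) ?nnegrE ?normr_ge0 //.
rewrite real_normK ?num_real // /A /B !exprMn sqr_sqrtr ?ltW //.
rewrite real_normK ?num_real // ltr_pM2r ?exprn_gt0 ?invr_gt0 //.
rewrite expr2 -mulrA ltr_pM2l //.
by move: superextremal; rewrite ltr_pdivrMr // mul1r.
Qed.

Lemma inner_radius_gt0 : 0 < inner_radius.
Proof.
by rewrite subr_gt0 (le_lt_trans (ler_norm _) superextremal_lengths).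
Qed.

Let AB : - B < A /\ A < B.
Proof. by apply/andP; rewrite -ltr_norml superextremal_lengths. Qed.

Let D0 : 0 < B ^+ 2 - A ^+ 2.
Proof. by case: AB => *; nra. Qed.

Lemma rho_of_rK (r : R) : 0 < r ->
  inner_radius < rho_of_r r /\ r_of_rho (rho_of_r r) = r.
Proof.
move=> r0; have [A1 A2] := AB; have D1 := D0.
rewrite /inner_radius /r_of_rho /rho_of_r.
set D := B ^+ 2 - A ^+ 2 in D1 *.
set s := Num.sqrt _.
have s0 : 0 <= s by exact: sqrtr_ge0.
have s2 : s ^+ 2 = (r - A) ^+ 2 + D by rewrite sqr_sqrtr // addr_ge0 ?sqr_ge0 // ltW.
have H : B - A < r - A + s.
  rewrite ltNge; apply/negP => sB.
  have : s ^+ 2 <= (B - r) ^+ 2 by rewrite lerXn2r ?nnegrE //; lra.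
  have : 0 < r * (B - A) by rewrite mulr_gt0 //; lra.
  by rewrite s2 /D; nra.
split=> //.
have n0 : r - A + s != 0 by rewrite gt_eqF //; lra.
have -> : D = s ^+ 2 - (r - A) ^+ 2 by rewrite s2; ring.
by field.
Qed.

Lemma r_of_rhoK (rho : R) : inner_radius < rho ->
  0 < r_of_rho rho /\ rho_of_r (r_of_rho rho) = rho.
Proof.
rewrite /inner_radius => hr; have [A1 A2] := AB; have D1 := D0.
rewrite /r_of_rho /rho_of_r.
have r0 : 0 < rho by lra.
split.
  have -> : A + (rho - (B ^+ 2 - A ^+ 2) / rho) / 2 =
    ((rho + A) ^+ 2 - B ^+ 2) / (2 * rho) by field; rewrite gt_eqF.
  by rewrite divr_gt0 ?mulr_gt0 //; nra.
set D := B ^+ 2 - A ^+ 2 in D1 *.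
have -> : (A + (rho - D / rho) / 2 - A) ^+ 2 + D = ((rho + D / rho) / 2) ^+ 2.
  by field; rewrite gt_eqF.
rewrite sqrtr_sqr ger0_norm; first by field; rewrite gt_eqF.
by rewrite divr_ge0 // addr_ge0 ?divr_ge0 // ltW.
Qed.

Let e2alphaE (r : R) : 0 < r ->
  e2alpha r = ((r - A) ^+ 2 + (B ^+ 2 - A ^+ 2)) / r ^+ 2.
Proof.
move=> r0; rewrite /e2alpha /A /B !exprMn sqr_sqrtr ?(ltW G0) //.
rewrite real_normK ?num_real //; field.
by rewrite !gt_eqF.
Qed.

Lemma e2alpha_gt0 (r : R) : 0 < r -> 0 < e2alpha r.
Proof.
by move=> r0; rewrite e2alphaE // divr_gt0 ?exprn_gt0 // ltr_wpDl ?sqr_ge0 ?D0.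
Qed.

Let pt4 (a b d e : R) : 'rV[R]_4 := \row_(i < 4) nth 0 [:: a; b; d; e] i.

Let derive1_pt4 (a b d e : R -> R) (u a' b' d' e' : R) :
  is_derive u 1 a a' -> is_derive u 1 b b' -> is_derive u 1 d d' ->
  is_derive u 1 e e' ->
  derive1 (fun s => pt4 (a s) (b s) (d s) (e s)) u = pt4 a' b' d' e'.
Proof.
move=> Ha Hb Hd He.
pose f (i : 'I_4) (s : R) : R := nth 0 [:: a s; b s; d s; e s] i.
pose f' (i : 'I_4) : R := nth 0 [:: a'; b'; d'; e'] i.
have H i : is_derive u 1 (f i) (f' i) by case: i => [[|[|[|[|//]]]] Hi].
have fE i : (fun s => pt4 (a s) (b s) (d s) (e s) 0 i) = f i.
  by apply/funext => s; rewrite mxE.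
rewrite derive1E derive_mx; last first.
  apply/derivable_mxP => i j; rewrite ord1 fE; exact: ex_derive.
apply/rowP => j; rewrite !mxE fE; exact: derive_val.
Qed.

Let is_derive_rho_of_r (r : R) : 0 < r ->
  is_derive r 1 rho_of_r
    (rho_of_r r / Num.sqrt ((r - A) ^+ 2 + (B ^+ 2 - A ^+ 2))).
Proof.
move=> r0.
have p0 : 0 < (r - A) ^+ 2 + (B ^+ 2 - A ^+ 2) by rewrite ltr_wpDl ?sqr_ge0 ?D0.
have H1 : is_derive r 1 (fun r => r - A) 1.
  by apply: is_derive_eq; rewrite subr0.
have H2 : is_derive r 1 (fun r => (r - A) ^+ 2 + (B ^+ 2 - A ^+ 2)) (2 * (r - A)).
  apply: is_derive_eq; rewrite ?addr0 /=. rewrite /GRing.scale /=; ring.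
have H3 := @is_derive1_comp R Num.sqrt
  (fun r => (r - A) ^+ 2 + (B ^+ 2 - A ^+ 2)) r _ _ (is_derive1_sqrt p0) H2.
apply: is_derive_eq; rewrite /rho_of_r.
have : Num.sqrt ((r - A) ^+ 2 + (B ^+ 2 - A ^+ 2)) != 0 by rewrite sqrtr_eq0 -ltNge.
by move=> s0; field.
Qed.

(* In the coordinates (t, r, theta, phi) the metric is
   - e^{2 alpha} c^2 dt^2 + e^{- 2 alpha} dr^2
     + r^2 (d theta^2 + sin^2 theta d phi^2). *)
Lemma rwn_metric_pullback (t r theta phi : R) : 0 < r ->
  let x t r theta phi := spherical t (rho_of_r r) theta phi in
  let J := \matrix_(i < 4) nth 0
    [:: derive1 (fun s => x s r theta phi) t;
        derive1 (fun s => x t s theta phi) r;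
        derive1 (fun s => x t r s phi) theta;
        derive1 (fun s => x t r theta s) phi] i in
  J *m rwn_metric (x t r theta phi) *m J^T =
  diag_mx (\row_(i < 4) nth 0
    [:: - (e2alpha r * c ^+ 2); (e2alpha r)^-1;
        r ^+ 2; r ^+ 2 * sin theta ^+ 2] i).
Proof.
move=> r0 x J; have [hr rK] := rho_of_rK r0.
set rho := rho_of_r r in hr rK.
have rho0 : 0 < rho by rewrite (lt_trans inner_radius_gt0).
have sphE a b d e : spherical a b d e =
    pt4 a (b * (sin d * cos e)) (b * (sin d * sin e)) (b * cos d) by [].
set s := Num.sqrt ((r - A) ^+ 2 + (B ^+ 2 - A ^+ 2)).
have s2 : s ^+ 2 = (r - A) ^+ 2 + (B ^+ 2 - A ^+ 2).
  by rewrite sqr_sqrtr // ltW // ltr_wpDl ?sqr_ge0 ?D0.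
have s0 : 0 < s by rewrite sqrtr_gt0 ltr_wpDl ?sqr_ge0 ?D0.
have Jt : derive1 (fun s => x s r theta phi) t = pt4 1 0 0 0.
  apply: (@derive1_pt4 id (cst (rho * (sin theta * cos phi)))
    (cst (rho * (sin theta * sin phi))) (cst (rho * cos theta))).
have Hr := is_derive_rho_of_r r0; rewrite -/rho -/s in Hr.
have Jr : derive1 (fun s => x t s theta phi) r =
    pt4 0 (rho / s * (sin theta * cos phi)) (rho / s * (sin theta * sin phi))
      (rho / s * cos theta).
  have Hk k : is_derive r 1 (fun s => rho_of_r s * k) (rho / s * k).
    by apply: is_derive_eq; rewrite scaler0 add0r /GRing.scale /= mulrC.
  by apply: (@derive1_pt4 (cst t) (fun s => rho_of_r s * (sin theta * cos phi))
    (fun s => rho_of_r s * (sin theta * sin phi))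
    (fun s => rho_of_r s * cos theta)).
have Jth : derive1 (fun s => x t r s phi) theta =
    pt4 0 (rho * (cos theta * cos phi)) (rho * (cos theta * sin phi))
      (- (rho * sin theta)).
  apply: (@derive1_pt4 (cst t) (fun s => rho * (sin s * cos phi))
    (fun s => rho * (sin s * sin phi)) (fun s => rho * cos s));
    apply: is_derive_eq; rewrite ?scaler0 /GRing.scale /=; ring.
have Jph : derive1 (fun s => x t r theta s) phi =
    pt4 0 (- (rho * (sin theta * sin phi))) (rho * (sin theta * cos phi)) 0.
  apply: (@derive1_pt4 (cst t) (fun s => rho * (sin theta * cos s))
    (fun s => rho * (sin theta * sin s)) (cst (rho * cos theta)));
    apply: is_derive_eq; rewrite ?scaler0 /GRing.scale /=; ring.
have trig (u : R) : cos u ^+ 2 = 1 - sin u ^+ 2 by rewrite -(cos2Dsin2 u) addrK.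
have nrm : spatial_norm (x t r theta phi) = rho.
  rewrite /spatial_norm /x sphE -/rho.
  rewrite !big_ord_recl big_ord0 !mxE /= addr0 -[RHS]gtr0_norm // -sqrtr_sqr.
  congr (Num.sqrt _); rewrite !exprMn !trig; ring.
have e2 : e2alpha r = s ^+ 2 / r ^+ 2 by rewrite e2alphaE // s2.
rewrite /J Jt Jr Jth Jph /rwn_metric nrm rK /phi2 rK e2.
have [rn sn rhon] : [/\ r != 0, s != 0 & rho != 0] by rewrite !gt_eqF.
have c2p := trig phi; have c2t := trig theta.
rewrite mul_mx_diag; apply/matrixP => i j; rewrite [LHS]mxE [RHS]mxE.
rewrite !big_ord_recl big_ord0 !mxE /=.
case: i => [[|[|[|[|//]]]] Hi]; case: j => [[|[|[|[|//]]]] Hj];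
  rewrite /= !mxE /= ?mulr0n ?mulr1n.
all: rewrite ?(mul0r, mulr0, addr0, add0r, mulr1).
all: try reflexivity.
all: clear -rn sn rhon c2p c2t.
all: move: (sin theta) (cos theta) (sin phi) (cos phi) c2p c2t => st ct sp cp c2p c2t.
all: try (field: c2p c2t; by rewrite ?rn ?sn ?rhon).
Qed.

End rwn.

(* Main.v *)
Require Import Defs.
From HB Require Import structures.
From mathcomp Require Import all_boot all_order all_algebra.
From mathcomp Require Import all_classical all_reals all_analysis.
From mathcomp Require Import measurable_realfun.
From mathcomp Require Import ring lra.
Import Order.TTheory GRing.Theory Num.Theory.
Import numFieldNormedType.Exports.
Local Open Scope classical_set_scope.
Local Open Scope ring_scope.

(* A radial test field already makes the boundary flux diverge.  In isotropic
   coordinates G^i_j x_j = - (B^2 / r^4) x_i and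
   sqrt |det g| = c s r^2 / rho^3 with s = r e^alpha, so for
   psi = f(t) h(rho) x the flux through the tube of radius rho is
   c B^2 s h(rho) / r^2 times the constant int f(t) sin theta.  As rho decreases
   to rho_0 the area radius r tends to 0 while s stays positive; hence
   r^2 times the flux has a nonzero limit, and the flux itself cannot
   converge to any number, in particular not to the bulk integral. *)

Set Implicit Arguments.
Unset Strict Implicit.
Unset Printing Implicit Defensive.

(** * Directional derivatives and flat functions *)

(** Compact support in the closed exterior leaves psi free on the sphere rho = rho_0, the image of
    the singularity r = 0; there the Coulomb stress B^2 / r^4 outweighs the factor r^2 of the volume
    density. Two demands shape the work. Test fields need all iterated partial derivatives up to the
    boundary: in Cartesian coordinates x itself is smooth, so cutoffs exp (- 1 / s) of polynomials
    in t and x give a field smooth on all of R^4. The curvature is defined by coordinate formulas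
    involving second derivatives of the metric; on a radial field the spatial part of G acts by its
    radial eigenvalue, from which second derivatives cancel, so explicit formulas are needed for
    first derivatives only. *)

Section directional.
Context {R : realType} {V : normedModType R}.

(** Restriction to a line reduces the chain rule for directional derivatives to one variable, with
    no differentiability of [f] on [V] to establish. *)
Lemma is_derive_along_line (f : V -> R) (x v : V) (d : R) :
  is_derive (0 : R) 1 (fun h : R => f (h *: v + x)) d <-> is_derive x v f d.
Proof.
have E : (fun h : R => h^-1 *: (((fun k : R => f (k *: v + x)) \o shift 0) (h *: 1) -
      f (0 *: v + x))) = (fun h => h^-1 *: ((f \o shift x) (h *: v) - f x)).
  apply/funext => h /=; rewrite addr0 scale0r add0r.
  by rewrite [h *: 1]mulr1.
split=> -[H1 H2]; apply: DeriveDef.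
- by move: H1; rewrite /derivable E.
- by move: H2; rewrite /derive E.
- by move: H1; rewrite /derivable E.
- by move: H2; rewrite /derive E.
Qed.

Lemma is_derive_comp1 (h : R -> R) (f : V -> R) (x v : V) (d h' : R) :
  is_derive (f x) 1 h h' -> is_derive x v f d ->
  is_derive x v (h \o f) (h' * d).
Proof.
move=> Hh /is_derive_along_line Hf; apply/is_derive_along_line.
apply: (@is_derive1_comp R h (fun k : R => f (k *: v + x))) => //.
by rewrite /= scale0r add0r.
Qed.

End directional.

Section coordinates.
Context {R : realType} {m : nat}.

Lemma is_derive_coord (x v : 'rV[R]_m) (j : 'I_m) :
  is_derive x v (fun y : 'rV[R]_m => y 0 j) (v 0 j).
Proof.
apply/is_derive_along_line.
have -> : (fun h : R => (h *: v + x) 0 j) = (fun h => h * v 0 j + x 0 j).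
  by apply/funext => h; rewrite !mxE.
by apply: is_derive_eq; rewrite ?scaler0 ?addr0 ?add0r /GRing.scale /= mulr1.
Qed.

End coordinates.

Section flat_functions.
Context {R : realType}.

(* flat 0 is the usual smooth cutoff exp (- 1 / s); the powers of 1 / s make the
   family closed under differentiation. *)
Definition flat (n : nat) (s : R) : R :=
  if 0 < s then s^-1 ^+ n * expR (- s^-1) else 0.

Lemma flat_ge0 n s : 0 <= flat n s.
Proof.
rewrite /flat; case: ifP => // s0.
by rewrite mulr_ge0 ?expR_ge0 // exprn_ge0 // invr_ge0 ltW.
Qed.

Lemma flat_gt0 n s : 0 < s -> 0 < flat n s.
Proof.
by move=> s0; rewrite /flat s0 mulr_gt0 ?expR_gt0 // exprn_gt0 // invr_gt0.
Qed.

Lemma flat_le0 n s : s <= 0 -> flat n s = 0.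
Proof. by rewrite /flat ltNge => ->. Qed.

(** With y = 1 / s, this is y^n / n! <= exp y, a single term of the exponential series. *)
Lemma flat_bounded n s : flat n s <= n`!%:R.
Proof.
rewrite /flat; case: ifP => [s0|_]; last by rewrite ler0n.
have i0 : 0 < s^-1 by rewrite invr_gt0.
rewrite expRN ler_pdivrMr ?expR_gt0 //.
case: n => [|n]; first by rewrite expr0 fact0 mul1r -expR0 ler_expR ltW.
have := expR_ge1Dxn n (ltW i0).
rewrite -(@ler_pM2l _ (n.+1`!%:R)) ?ltr0n ?fact_gt0 //; apply: le_trans.
by rewrite mulrDr mulr1 mulrCA divff ?mulr1 ?lerDr ?ler0n //.
Qed.

Lemma is_derive_flat n (s : R) :
  is_derive s 1 (flat n) (flat n.+2 s - n%:R * flat n.+1 s).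
Proof.
have [s0|s0|s0] := ltgtP 0 s.
- have sn : s != 0 by rewrite gt_eqF.
  apply: (@near_eq_is_derive _ _ _ (fun u : R => u^-1 ^+ n * expR (- u^-1))).
    near=> u; rewrite /flat; case: ifP => // /negP []; near: u.
    exact: lt_nbhsr.
  have Hi : is_derive s 1 (fun u : R => u^-1) (- s ^- 2).
    by have := @is_deriveV R id s 1 1 sn _; rewrite /GRing.scale /= mulr1; apply.
  have Hn : is_derive s 1 (fun u : R => - u^-1) (s ^- 2).
    by have := is_deriveN Hi; rewrite opprK.
  have He := @is_derive1_comp R expR _ s _ _ (is_derive_expR _) Hn.
  have Hx := @is_deriveX R _ (fun u : R => u^-1) n s 1 _ Hi.
  rewrite exprfctE in Hx.
  have Hm := is_deriveM Hx He.
  apply: (is_derive_eq Hm).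
  clear Hi Hn He Hx Hm.
  rewrite /= /flat s0 /GRing.scale /= !exprS.
  case: n => [|n]; rewrite ?expr0 ?mulr0n ?mul0r ?exprS; field => //.
- apply: (@near_eq_is_derive _ _ _ (cst (0 : R))).
    near=> u; rewrite /flat; case: ifP => // u0.
    have : u < 0 by near: u; exact: lt_nbhsl.
    by rewrite ltNge ltW.
  by rewrite !flat_le0 ?ltW // mulr0 subr0; exact: is_derive_cst.
- subst s; rewrite !flat_le0 // mulr0 subr0.
  suff H : (fun h : R => h^-1 *: ((flat n \o shift 0) (h *: 1) - flat n 0)) @ 0^'
     --> (0 : R).
    apply: DeriveDef; first by apply/cvg_ex; exists 0.
    exact/cvg_lim.
  (* For h > 0 the difference quotient at 0 is h * [flat n.+2 h], so the uniform bound on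
     [flat n.+2] makes it tend to 0. *)
  pose C : R := n.+2`!%:R.
  have HC : (fun h : R => `|h| * C) @ 0^' --> (0 : R).
    rewrite -[X in _ --> X](mul0r C).
    apply: cvgM; last exact: cvg_cst.
    rewrite -[X in _ --> X](@normr0 R R); apply: cvg_norm.
    exact/cvg_within.
  apply/norm_cvg0P.
  apply: (@squeeze_cvgr _ _ _ _ (cst 0) (fun h : R => `|h| * C)) => //; last first.
    exact: cvg_cst.
  near=> h; apply/andP; split; first exact: normr_ge0.
  rewrite /= addr0 [flat n 0]flat_le0 // subr0 [h *: 1]mulr1.
  have [h0|h0] := leP h 0; first by rewrite flat_le0 // scaler0 normr0 mulr_ge0 ?ler0n.
  have -> : h^-1 *: flat n h = h * flat n.+2 h.
    by rewrite /flat h0 /GRing.scale /= !exprS; field; rewrite gt_eqF.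
  by rewrite normrM ler_wpM2l // ger0_norm ?flat_ge0 ?flat_bounded.
Unshelve. all: by end_near. Qed.

Lemma flat_continuous n : continuous (flat n).
Proof.
move=> s; apply/differentiable_continuous/derivable1_diffP.
exact: (@ex_derive _ _ _ _ _ _ _ (is_derive_flat n s)).
Qed.

End flat_functions.

(** * A class of smooth functions closed under partial derivatives *)

Section flat_algebra.
Context {R : realType}.
Implicit Types f g : 'rV[R]_4 -> R.

(** Smoothness becomes an induction on terms: every generator is continuous and has its partial
    derivatives in the class, so the same holds for all iterated partials. *)
Inductive flat_algebra : ('rV[R]_4 -> R) -> Prop :=
| flat_algebra_cst (a : R) : flat_algebra (fun=> a)
| flat_algebra_coord (j : 'I_4) : flat_algebra (fun x => x 0 j)
| flat_algebra_add f g :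
    flat_algebra f -> flat_algebra g -> flat_algebra (fun x => f x + g x)
| flat_algebra_mul f g :
    flat_algebra f -> flat_algebra g -> flat_algebra (fun x => f x * g x)
| flat_algebra_flat n f :
    flat_algebra f -> flat_algebra (fun x => flat n (f x)).

Lemma flat_algebra_continuous f : flat_algebra f -> continuous f.
Proof.
elim=> [a|j|{}f g _ IHf _ IHg|{}f g _ IHf _ IHg|n {}f _ IHf] x.
- exact: cst_continuous.
- exact: coord_continuous.
- exact: (cvgD (IHf x) (IHg x)).
- exact: (cvgM (IHf x) (IHg x)).
- exact: (continuous_comp (IHf x) (@flat_continuous _ n (f x))).
Qed.

Lemma flat_algebra_partial i f : flat_algebra f ->
  exists2 g, flat_algebra g & forall x, is_derive x (delta_mx 0 i) f (g x).
Proof.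
elim=> [a|j|{}f g Af [f' Af' Hf] Ag [g' Ag' Hg]
  |{}f g Af [f' Af' Hf] Ag [g' Ag' Hg]|n {}f Af [f' Af' Hf]].
- by exists (fun=> 0); [exact: flat_algebra_cst|move=> x; exact: is_derive_cst].
- exists (fun=> (delta_mx 0 i : 'rV[R]_4) 0 j); first exact: flat_algebra_cst.
  by move=> x; exact: is_derive_coord.
- exists (fun x => f' x + g' x); first exact: flat_algebra_add.
  by move=> x; exact: is_deriveD.
- exists (fun x => f x * g' x + g x * f' x).
    by apply: flat_algebra_add; exact: flat_algebra_mul.
  by move=> x; exact: is_deriveM.
- exists (fun x => (flat n.+2 (f x) + - n%:R * flat n.+1 (f x)) * f' x).
    apply: flat_algebra_mul => //; apply: flat_algebra_add.
      exact: flat_algebra_flat.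
    apply: flat_algebra_mul; first exact: flat_algebra_cst.
    exact: flat_algebra_flat.
  move=> x; rewrite mulNr; apply: (@is_derive_comp1 _ _ (flat n) f) => //.
  exact: is_derive_flat.
Qed.

Lemma flat_algebra_iter_partial s f :
  flat_algebra f -> flat_algebra (iter_partial s f).
Proof.
move=> Af; elim: s => [//|i s IHs] /=.
have [g Ag Hg] := flat_algebra_partial i IHs.
suff -> : partial i (iter_partial s f) = g by [].
by apply/funext => x; exact: (@derive_val _ _ _ _ _ _ _ (Hg x)).
Qed.

Lemma flat_algebra_smooth A f : flat_algebra f -> smooth_on A f.
Proof.
move=> Af x Ax; exists setT, f; split=> //; first exact: openT.
move=> s y _; have As := flat_algebra_iter_partial s Af.
split; first exact: flat_algebra_continuous.
move=> i; have [g _ Hg] := flat_algebra_partial i As.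
exact: (@ex_derive _ _ _ _ _ _ _ (Hg y)).
Qed.

End flat_algebra.

(** * Curvature of static spatially conformally flat metrics *)

Lemma invmx_diag (F : fieldType) n (d : 'rV[F]_n) : (forall i, d 0 i != 0) ->
  invmx (diag_mx d) = diag_mx (\row_i (d 0 i)^-1).
Proof.
move=> d0.
have H : diag_mx (\row_i (d 0 i)^-1) *m diag_mx d = 1%:M.
  rewrite mulmx_diag -diag_const_mx; congr diag_mx.
  by apply/rowP => i; rewrite !mxE mulVf.
have U : diag_mx d \in unitmx by case/mulmx1_unit: H.
by rewrite -[LHS]mul1mx -H -mulmxA mulmxV // mulmx1.
Qed.

(** The indices are iterated lifts because [big_ord_recl] produces them in this form; the entries
    then agree syntactically for [ring] and [field]. *)
Lemma ord4_cases (P : 'I_4 -> Prop) : P ord0 -> P (lift ord0 ord0) ->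
  P (lift ord0 (lift ord0 ord0)) -> P (lift ord0 (lift ord0 (lift ord0 ord0))) ->
  forall i, P i.
Proof.
move=> P0 P1 P2 P3 [[|[|[|[|//]]]] Hi].
- by rewrite (_ : Ordinal Hi = ord0) //; exact: val_inj.
- by rewrite (_ : Ordinal Hi = lift ord0 ord0) //; exact: val_inj.
- by rewrite (_ : Ordinal Hi = lift ord0 (lift ord0 ord0)) //; exact: val_inj.
- by rewrite (_ : Ordinal Hi = lift ord0 (lift ord0 (lift ord0 ord0))) //;
    exact: val_inj.
Qed.

(** * Functions of the spatial norm *)

Section spatial_coordinates.
Context {R : realType}.
Implicit Types x : 'rV[R]_4.

(* The time coordinate is replaced by 0, so that the partial derivatives of a
   function of the spatial norm are given by one formula for all indices. *)
Definition spatial (k : 'I_4) x : R := if k == ord0 then 0 else x 0 k.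

Lemma spatial_normE x :
  spatial_norm x = Num.sqrt (\sum_(k < 4) spatial k x ^+ 2).
Proof. by rewrite big_ord_recl /spatial eqxx expr0n add0r. Qed.

Lemma spatial_norm_sqr x : \sum_(k < 4) spatial k x ^+ 2 = spatial_norm x ^+ 2.
Proof. by rewrite spatial_normE sqr_sqrtr // sumr_ge0 // => k _; exact: sqr_ge0. Qed.

Lemma spatial_norm_continuous : continuous (@spatial_norm R).
Proof.
move=> x; apply: continuous_comp; last exact: sqrt_continuous.
apply: (@cvg_big _ _ _ _ _ add_continuous _ (nbhs x)) => i _.
exact: (cvgM (@coord_continuous _ _ _ _ _ x) (@coord_continuous _ _ _ _ _ x)).
Qed.

Lemma exterior_open (rho0 : R) : open (exterior rho0).
Proof.
rewrite (_ : exterior rho0 = (@spatial_norm R) @^-1` [set u | rho0 < u]) //.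
by apply: open_comp => [x _|]; [exact: spatial_norm_continuous|exact: open_gt].
Qed.

Lemma is_derive_spatial x (i k : 'I_4) :
  is_derive x (delta_mx 0 i) (spatial k)
    (if (k != ord0) && (k == i) then 1 else 0).
Proof.
rewrite /spatial; case: eqP => [->|_] /=; first exact: is_derive_cst.
have := is_derive_coord x (delta_mx 0 i) k.
by rewrite mxE eqxx /=; case: eqP.
Qed.

Lemma is_derive_spatial_norm x (i : 'I_4) : 0 < spatial_norm x ->
  is_derive x (delta_mx 0 i) (@spatial_norm R) (spatial i x / spatial_norm x).
Proof.
move=> x0.
pose q y : R := \sum_(k < 4) spatial k y ^+ 2.
have Hq : is_derive x (delta_mx 0 i) q (2 * spatial i x).
  have Hk (k : 'I_4) : is_derive x (delta_mx 0 i) (fun y => spatial k y ^+ 2)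
     (2 * spatial k x * (if (k != ord0) && (k == i) then 1 else 0)).
    have := @is_deriveX R _ (spatial k) 2 x _ _ (is_derive_spatial x i k).
    by rewrite exprfctE expr1.
  have := @is_derive_sum R _ _ 4 (fun k y => spatial k y ^+ 2) x _ _ Hk.
  have -> : \sum_(k < 4) (fun y => spatial k y ^+ 2) = q.
    by apply/funext => y; rewrite /q fct_sumE.
  suff -> : \sum_(k < 4) 2 * spatial k x *
      (if (k != ord0) && (k == i) then 1 else 0) = 2 * spatial i x by [].
  rewrite (bigD1 i) //= big1 ?addr0 => [|k /negbTE ki]; last by rewrite ki andbF mulr0.
  by rewrite eqxx andbT; case: ifP => [|/negbFE/eqP ->]; rewrite ?mulr1 // /spatial !mulr0.
rewrite (_ : @spatial_norm R = Num.sqrt \o q); last first.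
  by apply/funext => y; rewrite /= spatial_normE.
have q0 : 0 < q x by rewrite /q spatial_norm_sqr exprn_gt0.
have := is_derive_comp1 (is_derive1_sqrt q0) Hq.
rewrite /= -[Num.sqrt (q x)]/(Num.sqrt (\sum_(k < 4) spatial k x ^+ 2)) -spatial_normE.
move=> H; apply: (is_derive_eq H); field; exact: lt0r_neq0.
Qed.

(** Writing h' as u * [h1] cancels the 1 / u in the gradient of the norm. All radial derivatives
    below follow this convention. *)
Lemma is_derive_radial (h : R -> R) (h1 : R) x (i : 'I_4) : 0 < spatial_norm x ->
  is_derive (spatial_norm x) 1 h (spatial_norm x * h1) ->
  is_derive x (delta_mx 0 i) (h \o @spatial_norm R) (spatial i x * h1).
Proof.
move=> x0 Hh.
apply: (is_derive_eq (is_derive_comp1 Hh (is_derive_spatial_norm i x0))).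
by field; exact: lt0r_neq0.
Qed.

End spatial_coordinates.

(** * Christoffel symbols, Ricci tensor and action of the Einstein tensor on radial fields *)

Section static_isotropic.
Context {R : realType}.
Context {E F a p a1 p1 : R -> R} {rho0 : R}.
(* E = g_tt and F = phi^4; u a(u) and u p(u) are the logarithmic derivatives of
   sqrt |E| and sqrt F, so that the Christoffel symbols are linear in the spatial
   coordinates over functions of the spatial norm. *)
Hypothesis rho0_ge0 : 0 <= rho0.
Hypothesis dE : forall u, rho0 < u -> is_derive u 1 E (u * (2 * a u * E u)).
Hypothesis dF : forall u, rho0 < u -> is_derive u 1 F (u * (2 * p u * F u)).
Hypothesis da : forall u, rho0 < u -> is_derive u 1 a (u * a1 u).
Hypothesis dp : forall u, rho0 < u -> is_derive u 1 p (u * p1 u).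
Hypothesis E0 : forall u, rho0 < u -> E u != 0.
Hypothesis F0 : forall u, rho0 < u -> F u != 0.
Implicit Types (x : 'rV[R]_4) (i j k l m n b : 'I_4).

(** [w] holds the logarithmic derivatives of the square roots of the coefficients, divided by u; [z]
    is their weight after lowering and raising an index, hence the factor E / F in the time
    direction. [w1] and [z1] are the derivatives of [w] and [z], again divided by u. *)
Let coef i (u : R) : R := if i == ord0 then E u else F u.
Let w i (u : R) : R := if i == ord0 then a u else p u.
Let w1 i (u : R) : R := if i == ord0 then a1 u else p1 u.
Let z i (u : R) : R := if i == ord0 then a u * (E u / F u) else p u.
Let z1 i (u : R) : R :=
  if i == ord0 then (a1 u + 2 * a u * (a u - p u)) * (E u / F u) else p1 u.

Definition static_isotropic x : 'M[R]_4 :=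
  diag_mx (\row_(i < 4)
    if i == ord0 then E (spatial_norm x) else F (spatial_norm x)).

Let g := static_isotropic.

Let coef0 i u : rho0 < u -> coef i u != 0.
Proof. by move=> u0; rewrite /coef; case: ifP => _; [exact: E0|exact: F0]. Qed.

Let pos x : rho0 < spatial_norm x -> 0 < spatial_norm x.
Proof. exact: le_lt_trans. Qed.

Lemma static_isotropic_inv x m n : rho0 < spatial_norm x ->
  invmx (g x) m n = (coef m (spatial_norm x))^-1 *+ (m == n).
Proof.
move=> x0; rewrite /g /static_isotropic invmx_diag => [|i].
  by rewrite !mxE.
by rewrite mxE; exact: (coef0 i x0).
Qed.

Let is_derive_coef i k x : rho0 < spatial_norm x ->
  is_derive x (delta_mx 0 k) (coef i \o @spatial_norm R)
    (2 * spatial k x * w i (spatial_norm x) * coef i (spatial_norm x)).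
Proof.
move=> x0; rewrite /coef /w; case: ifP => _.
  apply: (is_derive_eq (is_derive_radial k (pos x0) (dE x0))); ring.
apply: (is_derive_eq (is_derive_radial k (pos x0) (dF x0))); ring.
Qed.

Let partial_metric i j k x : rho0 < spatial_norm x ->
  partial k (fun y => g y i j) x =
  2 * spatial k x * w i (spatial_norm x) * coef i (spatial_norm x) *+ (i == j).
Proof.
move=> x0.
have -> : (fun y => g y i j) =
    if i == j then coef i \o @spatial_norm R else fun=> 0.
  by apply/funext => y; rewrite !mxE; case: (i =P j).
case: (i =P j) => _; rewrite ?mulr0n ?mulr1n; last exact: derive_cst.
exact: (@derive_val _ _ _ _ _ _ _ (is_derive_coef i k x0)).
Qed.

(** The shape of the Christoffel symbols of a conformally flat metric, with separate weights for
    time: one formula covers all 64 components, since [spatial ord0] vanishes. *)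
Let gam l m n x : R := let u := spatial_norm x in
  (if l == n then spatial m x * w l u else 0)
  + (if l == m then spatial n x * w l u else 0)
  - (if m == n then spatial l x * z m u else 0).

Lemma christoffel_static_isotropic l m n x : rho0 < spatial_norm x ->
  christoffel g l m n x = gam l m n x.
Proof.
move=> x0; rewrite /christoffel (bigD1 l) //= big1 ?addr0; last first.
  by move=> i /negbTE il; rewrite static_isotropic_inv // eq_sym il mul0r.
rewrite static_isotropic_inv // eqxx !partial_metric // /gam.
have Ex := E0 x0; have Fx := F0 x0.
move: l m n; do 3 (apply: ord4_cases); rewrite /w /z /coef /spatial /=;
  by rewrite ?mulr0n ?mulr1n; field; rewrite ?Ex ?Fx.
Qed.

Let dgam k l m n x : R := let u := spatial_norm x in
  let d i := if (i != ord0) && (i == k) then 1 else 0 in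
  let y i := spatial i x in
  (if l == n then d m * w l u + y m * y k * w1 l u else 0)
  + (if l == m then d n * w l u + y n * y k * w1 l u else 0)
  - (if m == n then d l * z m u + y l * y k * z1 m u else 0).

Let is_derive_w i k x : rho0 < spatial_norm x ->
  is_derive x (delta_mx 0 k) (w i \o @spatial_norm R)
    (spatial k x * w1 i (spatial_norm x)).
Proof.
move=> x0; rewrite /w /w1; case: ifP => _.
  exact: is_derive_radial (pos x0) (da x0).
exact: is_derive_radial (pos x0) (dp x0).
Qed.

Let is_derive_z i k x : rho0 < spatial_norm x ->
  is_derive x (delta_mx 0 k) (z i \o @spatial_norm R)
    (spatial k x * z1 i (spatial_norm x)).
Proof.
move=> x0; rewrite /z /z1; case: ifP => _; last first.
  exact: is_derive_radial (pos x0) (dp x0).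
have Fx := F0 x0; have Hi := is_deriveV Fx (dF x0).
apply: is_derive_radial (pos x0) _.
have := is_deriveM (da x0) (is_deriveM (dE x0) Hi).
move=> H; apply: (is_derive_eq H); rewrite mulrfctE /GRing.scale /=; field.
exact: Fx.
Qed.

Let is_derive_if (c : bool) (f : 'rV[R]_4 -> R) x v (d : R) :
  is_derive x v f d ->
  is_derive x v (fun y => if c then f y else 0) (if c then d else 0).
Proof. by case: c => // _; exact: is_derive_cst. Qed.

Lemma partial_christoffel_static_isotropic k l m n x : rho0 < spatial_norm x ->
  partial k (christoffel g l m n) x = dgam k l m n x.
Proof.
(* The closed form holds only outside the ball; as the exterior is open, the two functions agree
   near [x], which is enough to differentiate. *)
move=> x0; rewrite /partial (@near_eq_derive _ _ _ _ (gam l m n)); last first.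
  have : nbhs x (exterior rho0) by apply: open_nbhs_nbhs; split=> //; exact: exterior_open.
  by apply: filterS => y y0; exact: christoffel_static_isotropic.
have term i j : is_derive x (delta_mx 0 k)
    (fun y => spatial i y * w j (spatial_norm y))
    ((if (i != ord0) && (i == k) then 1 else 0) * w j (spatial_norm x)
     + spatial i x * spatial k x * w1 j (spatial_norm x)).
  have H := is_deriveM (is_derive_spatial x k i) (is_derive_w j k x0).
  by apply: (is_derive_eq H); rewrite /GRing.scale /=; ring.
have termz i j : is_derive x (delta_mx 0 k)
    (fun y => spatial i y * z j (spatial_norm y))
    ((if (i != ord0) && (i == k) then 1 else 0) * z j (spatial_norm x)
     + spatial i x * spatial k x * z1 j (spatial_norm x)).
  have H := is_deriveM (is_derive_spatial x k i) (is_derive_z j k x0).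
  by apply: (is_derive_eq H); rewrite /GRing.scale /=; ring.
have H := is_deriveB (is_deriveD (is_derive_if (l == n) (term m l))
  (is_derive_if (l == m) (term n l))) (is_derive_if (m == n) (termz l m)).
exact: (@derive_val _ _ _ _ _ _ _ H).
Qed.

(** Once u^2 is replaced by coordinates, the curvature identities are rational identities in
    independent atoms. *)
Let usqr x : spatial_norm x ^+ 2 = x 0 (lift ord0 ord0) ^+ 2 +
  x 0 (lift ord0 (lift ord0 ord0)) ^+ 2 +
  x 0 (lift ord0 (lift ord0 (lift ord0 ord0))) ^+ 2.
Proof.
by rewrite -spatial_norm_sqr !big_ord_recl big_ord0 /spatial /= expr0n /= add0r addr0 addrA.
Qed.

Let ricciE b n x : rho0 < spatial_norm x ->
  ricci g b n x = \sum_(c < 4) (dgam c c n b x - dgam n c c b x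
    + \sum_(l < 4) (gam c c l x * gam l n b x - gam c n l x * gam l c b x)).
Proof.
move=> x0; apply: eq_bigr => c _; rewrite /riemann.
rewrite !partial_christoffel_static_isotropic //; congr (_ + _).
by apply: eq_bigr => l _; rewrite !christoffel_static_isotropic.
Qed.

Lemma ricci_time_static_isotropic x : rho0 < spatial_norm x ->
  let u := spatial_norm x in
  ricci g ord0 ord0 x =
  - (E u / F u) * (3 * a u + (a1 u + a u ^+ 2 + a u * p u) * u ^+ 2).
Proof.
move=> x0 u; rewrite ricciE // !big_ord_recl !big_ord0 /gam /dgam /spatial /=.
rewrite /w /z /w1 /z1 -/u /=.
by rewrite usqr; ring.
Qed.

Lemma ricci_space_static_isotropic x b n : rho0 < spatial_norm x ->
  b != ord0 -> n != ord0 -> let u := spatial_norm x in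
  ricci g b n x =
  x 0 b * x 0 n * (p u ^+ 2 - p1 u - a1 u - a u ^+ 2 + 2 * a u * p u)
  - (4 * p u + a u + (p1 u + p u ^+ 2 + a u * p u) * u ^+ 2) *+ (b == n).
Proof.
move=> x0 + + u; rewrite ricciE // usqr.
move: b n; do 2 (apply: ord4_cases) => //.
all: move=> _ _; rewrite !big_ord_recl !big_ord0 /gam /dgam /spatial /=.
all: rewrite /w /z /w1 /z1 -/u /= ?mulr0n ?mulr1n.
all: ring.
Qed.

Let ricci_mixed_static_isotropic m n x : rho0 < spatial_norm x ->
  ricci_mixed g m n x = (coef m (spatial_norm x))^-1 * ricci g m n x.
Proof.
move=> x0; rewrite /ricci_mixed (bigD1 m) //= big1 ?addr0; last first.
  by move=> i /negbTE im; rewrite static_isotropic_inv // eq_sym im mul0r.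
by rewrite static_isotropic_inv // eqxx.
Qed.

(** [a1] and [p1], which carry the second derivatives of the metric, cancel: the radial eigenvalue
    of G is of first order in the metric. *)
Lemma einstein_contract_static_isotropic (psi : 'rV[R]_4 -> 'rV[R]_4) (f : R) x m :
  rho0 < spatial_norm x -> (forall n, psi x 0 n = spatial n x * f) ->
  m != ord0 -> let u := spatial_norm x in
  einstein_contract g psi x 0 m =
  x 0 m * f * ((2 * p u + 2 * a u + (p u ^+ 2 + 2 * a u * p u) * u ^+ 2) / F u).
Proof.
move=> x0 psiE m0 u; have Ex := E0 x0; have Fx := F0 x0.
rewrite mxE !big_ord_recl big_ord0 !psiE.
rewrite [spatial ord0 x]/(0 : R) mul0r mulr0 add0r.
rewrite /einstein /scalar_curvature !big_ord_recl big_ord0.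
rewrite !ricci_mixed_static_isotropic // ricci_time_static_isotropic //.
move: m m0; apply: ord4_cases => //= _;
  rewrite !ricci_space_static_isotropic //= /coef /spatial /= -/u.
all: by rewrite (usqr x : u ^+ 2 = _) ?mulr0n ?mulr1n; field; rewrite ?Ex ?Fx.
Qed.

Lemma volume_density_static_isotropic x :
  volume_density g x =
  Num.sqrt `|E (spatial_norm x) * F (spatial_norm x) ^+ 3|.
Proof.
rewrite /volume_density det_diag !big_ord_recl big_ord0 !mxE /=.
by congr (Num.sqrt `|_|); ring.
Qed.

End static_isotropic.

(** Moving the time row above [X] costs a sign, so the value is minus the triple product X . (V x W)
    of the spatial parts. *)
Lemma det_time_row (R : comNzRingType) (X V W : 'rV[R]_4) :
  V 0 ord0 = 0 -> W 0 ord0 = 0 ->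
  let i1 : 'I_4 := lift ord0 ord0 in let i2 : 'I_4 := lift ord0 (lift ord0 ord0) in
  let i3 : 'I_4 := lift ord0 (lift ord0 (lift ord0 ord0)) in
  \det (\matrix_(i < 4) nth 0 [:: X; delta_mx 0 0; V; W] i) =
  X 0 i1 * (V 0 i3 * W 0 i2 - V 0 i2 * W 0 i3)
  + X 0 i2 * (V 0 i1 * W 0 i3 - V 0 i3 * W 0 i1)
  + X 0 i3 * (V 0 i2 * W 0 i1 - V 0 i1 * W 0 i2).
Proof.
move=> V0 W0 i1 i2 i3.
rewrite (expand_det_col _ ord0) !big_ord_recl big_ord0 !mxE /= ?mxE /= V0 W0 !mul0r !addr0.
rewrite /cofactor.
do 2 (rewrite ?(expand_det_row _ ord0) !big_ord_recl !big_ord0 /cofactor).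
rewrite ?[\det _](expand_det_row _ ord0).
rewrite ?big_ord_recl ?big_ord0 /cofactor ?det_mx00.
rewrite !mxE /= ?mxE /=.
(* Indexing the entries by natural numbers identifies ordinals that differ only in their
   presentation, before [ring] is called. *)
have entry (Y : 'rV[R]_4) : exists y : nat -> R, forall i, Y 0 i = y i.
  by exists (fun k => Y 0 (inord k)) => i; rewrite inord_val.
have [[x Xx] [v Vv] [w Ww]] := And3 (entry X) (entry V) (entry W).
rewrite !Xx !Vv !Ww /= /bump /= !(addn0, add0n).
ring.
Qed.

(** * The Einstein tensor of the Reissner-Weyl-Nordstrom metric *)

Section rwn_einstein.
Context {R : realType} {G c M Q : R}.
Hypotheses (G_gt0 : 0 < G) (c_gt0 : 0 < c) (Q_neq0 : Q != 0)
  (superextremal : G * M ^+ 2 / Q ^+ 2 < 1).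

Local Notation A := (mass_length G c M).
Local Notation B := (charge_length G c Q).
Local Notation r := (r_of_rho G c M Q).
Local Notation rho0 := (inner_radius G c M Q).

(* r e^alpha = sqrt ((r - A)^2 + B^2 - A^2), as a function of the isotropic
   radius. *)
Definition r_exp_alpha (u : R) : R := (u + (B ^+ 2 - A ^+ 2) / u) / 2.

Local Notation s := r_exp_alpha.

Let E (u : R) : R := - (e2alpha G c M Q (r u) * c ^+ 2).
Let F (u : R) : R := phi2 G c M Q u ^+ 2.
(** [a] and [p] are the logarithmic derivatives of e^alpha = s / r and of phi^2 = r / u, divided by
    u, computed from r' = s / u and s' = (r - A) / u. *)
Let a (u : R) : R := (A * r u - B ^+ 2) * ((r u)^-1 * (s u)^-1 * u^-1 ^+ 2).
Let p (u : R) : R := (s u - r u) * ((r u)^-1 * u^-1 ^+ 2).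

Let rho0_gt0 : 0 < rho0.
Proof. exact: inner_radius_gt0. Qed.

Let gap_gt0 : 0 < B ^+ 2 - A ^+ 2.
Proof.
have := superextremal_lengths G_gt0 c_gt0 Q_neq0 superextremal.
by rewrite ltr_norml => /andP[? ?]; nra.
Qed.

Let r_gt0 u : rho0 < u -> 0 < r u.
Proof. by move=> /(r_of_rhoK G_gt0 c_gt0 Q_neq0 superextremal) []. Qed.

Let s_gt0 (u : R) : 0 < u -> 0 < s u.
Proof. by move=> u0; rewrite /r_exp_alpha divr_gt0 // addr_gt0 // divr_gt0. Qed.

(** The one algebraic relation used between s and r: the later computations generalize both and hand
    this equation to [field]. *)
Let s_sqr (u : R) : u != 0 -> s u ^+ 2 = r u ^+ 2 - 2 * A * r u + B ^+ 2.
Proof. by move=> u0; rewrite /r_exp_alpha /r_of_rho; field. Qed.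

Lemma e2alphaE v : e2alpha G c M Q v = 1 - 2 * A * v^-1 + B ^+ 2 * v^-1 ^+ 2.
Proof.
have cn : c != 0 by rewrite gt_eqF.
have -> : B ^+ 2 = G * Q ^+ 2 / c ^+ 4.
  rewrite /charge_length !exprMn sqr_sqrtr ?ltW // real_normK ?num_real //.
  by field.
(* At v = 0 both sides equal 1, because inverses of 0 are 0; the unconditional identity can then be
   used under function extensionality. *)
rewrite /e2alpha /mass_length; have [->|vn] := eqVneq v 0; last by field; rewrite ?cn ?vn.
by rewrite expr0n /= !mulr0 invr0 expr0n /= !mulr0.
Qed.

Let is_derive_inv (u : R) : u != 0 -> is_derive u 1 (fun u : R => u^-1) (- u^-1 ^+ 2).
Proof.
move=> un; have := @is_deriveV R id u 1 1 un _.
by rewrite /GRing.scale /= mulr1 exprVn; apply.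
Qed.

Let is_derive_invf (f : R -> R) (u d : R) : f u != 0 -> is_derive u 1 f d ->
  is_derive u 1 (fun u => (f u)^-1) (- (f u)^-1 ^+ 2 * d).
Proof.
move=> fu Hf; have := is_deriveV fu Hf.
by rewrite /GRing.scale /= exprVn.
Qed.

Let is_derive_r u : rho0 < u -> is_derive u 1 r (s u / u).
Proof.
move=> hu; have u0 : u != 0 by rewrite gt_eqF // (lt_trans rho0_gt0).
have Hi := is_derive_inv u0.
rewrite /r_of_rho; apply: is_derive_eq.
rewrite /GRing.scale /= /r_exp_alpha; field; exact: u0.
Qed.

Let is_derive_s u : rho0 < u -> is_derive u 1 s ((r u - A) / u).
Proof.
move=> hu; have u0 : u != 0 by rewrite gt_eqF // (lt_trans rho0_gt0).
have Hi := is_derive_inv u0.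
rewrite /r_exp_alpha; apply: is_derive_eq.
rewrite /GRing.scale /= /r_of_rho; field; exact: u0.
Qed.

Let is_derive_E u : rho0 < u -> is_derive u 1 E (u * (2 * a u * E u)).
Proof.
move=> hu; have u0 : u != 0 by rewrite gt_eqF // (lt_trans rho0_gt0).
have rn : r u != 0 by rewrite gt_eqF // r_gt0.
have sn : s u != 0 by rewrite gt_eqF // s_gt0 // (lt_trans rho0_gt0).
have Hr := is_derive_invf rn (is_derive_r hu).
rewrite /E [X in is_derive _ _ X](_ : _ = fun u =>
  - ((1 - 2 * A * (r u)^-1 + B ^+ 2 * (r u)^-1 ^+ 2) * c ^+ 2)); last first.
  by apply/funext => v; rewrite e2alphaE.
apply: is_derive_eq.
rewrite /GRing.scale /= e2alphaE /a.
have S := s_sqr u0; move: S rn sn.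
move: (s u) (r u) => S r' H rn sn.
by field: H; rewrite ?u0 ?rn ?sn.
Qed.

Let is_derive_F u : rho0 < u -> is_derive u 1 F (u * (2 * p u * F u)).
Proof.
move=> hu; have u0 : u != 0 by rewrite gt_eqF // (lt_trans rho0_gt0).
have rn : r u != 0 by rewrite gt_eqF // r_gt0.
have Hr := is_derive_r hu; have Hi := is_derive_inv u0.
rewrite /F /phi2; apply: is_derive_eq.
rewrite /GRing.scale /= /p.
by field; rewrite ?u0 ?rn.
Qed.

(** Puts any derivative in the form u * f1 u. Since [a1] and [p1] cancel in the final formula,
    differentiability of [a] and [p] suffices and no closed form is computed. *)
Let is_derive_quotient (f : R -> R) u : rho0 < u -> derivable f u 1 ->
  is_derive u 1 f (u * (derive1 f u / u)).
Proof.
move=> hu /derivableP Hf; apply: (is_derive_eq Hf); rewrite derive1E.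
by field; rewrite gt_eqF // (lt_trans rho0_gt0).
Qed.

Let derivable_a u : rho0 < u -> derivable a u 1.
Proof.
move=> hu; have u0 : u != 0 by rewrite gt_eqF // (lt_trans rho0_gt0).
have rn : r u != 0 by rewrite gt_eqF // r_gt0.
have sn : s u != 0 by rewrite gt_eqF // s_gt0 // (lt_trans rho0_gt0).
have Hr := is_derive_r hu; have Hi := is_derive_inv u0.
have Hri := is_derive_invf rn Hr; have Hsi := is_derive_invf sn (is_derive_s hu).
rewrite /a; apply: ex_derive.
Qed.

Let derivable_p u : rho0 < u -> derivable p u 1.
Proof.
move=> hu; have u0 : u != 0 by rewrite gt_eqF // (lt_trans rho0_gt0).
have rn : r u != 0 by rewrite gt_eqF // r_gt0.
have Hr := is_derive_r hu; have Hi := is_derive_inv u0.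
have Hri := is_derive_invf rn Hr; have Hs := is_derive_s hu.
rewrite /p; apply: ex_derive.
Qed.

Let EE u : rho0 < u -> E u = - (c * s u / r u) ^+ 2.
Proof.
move=> hu; have u0 : u != 0 by rewrite gt_eqF // (lt_trans rho0_gt0).
have rn : r u != 0 by rewrite gt_eqF // r_gt0.
rewrite /E e2alphaE; have S := s_sqr u0.
move: (s u) (r u) S rn => s' r' S rn.
by field: S.
Qed.

Let E_neq0 u : rho0 < u -> E u != 0.
Proof.
move=> hu; rewrite EE // oppr_eq0 expf_eq0 /=.
by rewrite gt_eqF // divr_gt0 ?r_gt0 // mulr_gt0 // s_gt0 // (lt_trans rho0_gt0).
Qed.

Let F_neq0 u : rho0 < u -> F u != 0.
Proof.
move=> hu; rewrite /F /phi2 expf_eq0 /=.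
by rewrite gt_eqF // divr_gt0 ?r_gt0 // (lt_trans rho0_gt0).
Qed.

(** Since 1 + p u^2 = s / r, the eigenvalue is (s^2 - r^2 + 2 (A r - B^2)) / r^4; by [s_sqr] the
    mass term cancels and - B^2 / r^4, the radial Coulomb stress, remains. *)
Lemma einstein_contract_rwn_radial (psi : 'rV[R]_4 -> 'rV[R]_4) (f : R) x m :
  rho0 < spatial_norm x -> (forall n, psi x 0 n = spatial n x * f) ->
  m != ord0 -> einstein_contract (rwn_metric G c M Q) psi x 0 m =
  - (x 0 m * f * (B ^+ 2 / r (spatial_norm x) ^+ 4)).
Proof.
move=> hx psiE m0.
have := einstein_contract_static_isotropic (ltW rho0_gt0) is_derive_E is_derive_F
  (fun u hu => is_derive_quotient hu (derivable_a hu))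
  (fun u hu => is_derive_quotient hu (derivable_p hu)) E_neq0 F_neq0 hx psiE m0.
rewrite [einstein_contract _ _ _ _ _]/(einstein_contract (rwn_metric G c M Q) psi x 0 m).
move=> ->; move: (spatial_norm x) hx => u hu.
have u0 : u != 0 by rewrite gt_eqF // (lt_trans rho0_gt0).
have rn : r u != 0 by rewrite gt_eqF // r_gt0.
have sn : s u != 0 by rewrite gt_eqF // s_gt0 // (lt_trans rho0_gt0).
have S := s_sqr u0.
rewrite -mulrN; congr (_ * _); rewrite /p /a /F /phi2.
move: (s u) (r u) S rn sn => s' r' S rn sn.
by field: S; rewrite ?u0 ?rn ?sn.
Qed.

Lemma volume_density_rwn x : rho0 < spatial_norm x ->
  let u := spatial_norm x in
  volume_density (rwn_metric G c M Q) x = c * s u * r u ^+ 2 / u ^+ 3.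
Proof.
move=> hx u.
have u0 : 0 < u by rewrite (lt_trans rho0_gt0).
rewrite [LHS](volume_density_static_isotropic (E := E) (F := F)) -/u EE // /F /phi2.
rewrite mulNr normrN -exprM mulnC exprM -exprMn ger0_norm ?sqr_ge0 // sqrtr_sqr.
have H := r_gt0 hx; have Hs := s_gt0 u0.
rewrite ger0_norm.
  by field; rewrite !gt_eqF.
exact: ltW (mulr_gt0 (divr_gt0 (mulr_gt0 c_gt0 Hs) H) (exprn_gt0 3 (divr_gt0 H u0))).
Qed.

End rwn_einstein.

Arguments r_exp_alpha {R} G c M Q u.

(** * The test field and the geometry of the tubes *)

Section test_field.
Context {R : realType}.
Implicit Types (K : R) (x : 'rV[R]_4).

(** Supported in |t| <= 1 and |x|^2 <= K, and positive inside. Differences and squares are spelled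
    as sums and products to match the constructors of [flat_algebra]. *)
Definition time_space_bump K x : R :=
  flat 0 (1 + -1 * (x 0 ord0 * x 0 ord0)) *
  flat 0 (K + -1 * \sum_(k < 4) spatial k x * spatial k x).

Definition radial_bump K x : 'rV[R]_4 :=
  \row_n (spatial n x * time_space_bump K x).

Lemma flat_algebra_spatial (k : 'I_4) : flat_algebra (fun x => spatial k x).
Proof.
have -> : (fun x => spatial k x) = if k == ord0 then fun=> 0 else fun x => x 0 k.
  by apply/funext => x; rewrite /spatial; case: ifP.
case: ifP => _; first exact: flat_algebra_cst.
exact: flat_algebra_coord.
Qed.

Lemma flat_algebra_sum n (f : 'I_n -> 'rV[R]_4 -> R) :
  (forall i, flat_algebra (f i)) -> flat_algebra (fun x => \sum_(i < n) f i x).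
Proof.
elim: n f => [|n IHn] f Hf.
  under eq_fun do rewrite big_ord0; exact: flat_algebra_cst.
under eq_fun do rewrite big_ord_recl.
by apply: flat_algebra_add; [exact: Hf|apply: IHn => i; exact: Hf].
Qed.

Lemma flat_algebra_bump K : flat_algebra (time_space_bump K).
Proof.
apply: flat_algebra_mul; apply: flat_algebra_flat; apply: flat_algebra_add;
  try exact: flat_algebra_cst; apply: flat_algebra_mul;
  try exact: flat_algebra_cst.
  by apply: flat_algebra_mul; exact: flat_algebra_coord.
apply: flat_algebra_sum => k.
by apply: flat_algebra_mul; exact: flat_algebra_spatial.
Qed.

(** A coordinate larger than K + 1 >= 1 in absolute value has a square above both 1 and K, so one of
    the two cutoffs vanishes. *)
Lemma time_space_bump_out K x : 0 <= K -> time_space_bump K x != 0 ->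
  forall i, `|x 0 i| <= K + 1.
Proof.
move=> K0 x0 i; rewrite leNgt; apply: contra x0 => xi.
have x1 : K + 1 < `|x 0 i| ^+ 2.
  by rewrite expr2; nra.
rewrite real_normK ?num_real // in x1.
rewrite /time_space_bump mulf_eq0; have [i0|i0] := eqVneq i ord0.
  by rewrite -i0 flat_le0 ?eqxx //; rewrite expr2 in x1; lra.
apply/orP; right; rewrite flat_le0 //.
suff : x 0 i ^+ 2 <= \sum_(k < 4) spatial k x * spatial k x by lra.
rewrite (bigD1 i) //= {1 2}/spatial (negbTE i0) -expr2 lerDl.
by apply: sumr_ge0 => k _; rewrite -expr2 sqr_ge0.
Qed.

Lemma radial_bump_smooth_compactly_supported A K : 0 <= K ->
  smooth_compactly_supported A (radial_bump K).
Proof.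
move=> K0; split=> [i|].
  apply: flat_algebra_smooth; under eq_fun do rewrite mxE.
  apply: flat_algebra_mul; [exact: flat_algebra_spatial|exact: flat_algebra_bump].
pose C := [set v : 'rV[R]_4 | forall i, `[- (K + 1), K + 1]%classic (v ord0 i)].
have Cc : compact C.
  by apply: (@rV_compact _ _ (fun=> `[- (K + 1), K + 1]%classic)) => _; exact: segment_compact.
have Ccl : closed C by apply: compact_closed Cc; exact: norm_hausdorff.
apply: (subclosed_compact _ Cc); first exact: closed_closure.
move/closure_id: Ccl => ->; apply: closureS => x [_ x0] i /=.
rewrite in_itv /= -ler_norml; apply: time_space_bump_out => //.
apply: contra x0 => /eqP b0; apply/eqP/rowP => n.
by rewrite !mxE b0 mulr0.
Qed.

End test_field.

Section tube.
Context {R : realType}.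

Lemma derive1_point (a b d e : R -> R) (u a' b' d' e' : R) :
  is_derive u 1 a a' -> is_derive u 1 b b' -> is_derive u 1 d d' ->
  is_derive u 1 e e' ->
  derive1 (fun s => Defs.point (a s, b s, d s, e s)) u = Defs.point (a', b', d', e').
Proof.
move=> Ha Hb Hd He.
have H (i : 'I_4) : is_derive u 1
    (fun s => Defs.point (a s, b s, d s, e s) 0 i) (Defs.point (a', b', d', e') 0 i).
  rewrite (_ : (fun s => _) = fun s => nth 0 [:: a s; b s; d s; e s] i); last first.
    by apply/funext => s; rewrite mxE.
  by rewrite mxE; case: i => [[|[|[|[|//]]]] Hi].
rewrite derive1E derive_mx; last first.
  by apply/derivable_mxP => i j; rewrite ord1; exact: (@ex_derive _ _ _ _ _ _ _ (H j)).
by apply/rowP => j; rewrite [LHS]mxE; exact: (@derive_val _ _ _ _ _ _ _ (H j)).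
Qed.

Let cos2_sin2 (v : R) : cos v ^+ 2 = 1 - sin v ^+ 2.
Proof. by rewrite -(cos2Dsin2 v) addrK. Qed.

Variables t u theta phi : R.

Lemma derive1_spherical_time :
  derive1 (fun s => spherical s u theta phi) t = delta_mx 0 0.
Proof.
rewrite (@derive1_point id (cst _) (cst _) (cst _) t 1 0 0 0).
by apply/rowP; apply: ord4_cases; rewrite !mxE.
Qed.

Lemma derive1_spherical_theta :
  derive1 (fun s => spherical t u s phi) theta =
  Defs.point (0, u * (cos theta * cos phi), u * (cos theta * sin phi),
         - (u * sin theta)).
Proof.
apply: (@derive1_point (cst t)); apply: is_derive_eq;
  rewrite ?scaler0 /GRing.scale /=; ring.
Qed.

Lemma derive1_spherical_phi :
  derive1 (fun s => spherical t u theta s) phi =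
  Defs.point (0, - (u * (sin theta * sin phi)), u * (sin theta * cos phi), 0).
Proof.
apply: (@derive1_point (cst t) _ _ (cst (u * cos theta))); apply: is_derive_eq;
  rewrite ?scaler0 /GRing.scale /=; ring.
Qed.

Lemma spatial_norm_spherical : 0 <= u ->
  spatial_norm (spherical t u theta phi) = u.
Proof.
move=> u0; rewrite /spatial_norm !big_ord_recl big_ord0 !mxE /= addr0.
rewrite -[RHS]ger0_norm // -sqrtr_sqr; congr (Num.sqrt _).
have := cos2_sin2 theta; have := cos2_sin2 phi.
move: (sin theta) (cos theta) (sin phi) (cos phi) => a b d e H1 H2.
by ring: H1 H2.
Qed.

(** The position vector has triple product u^3 sin theta with the two angular tangents; the minus
    sign records that the boundary normal points towards the ball. *)
Lemma det_spherical_tube (X : 'rV[R]_4) (k : R) :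
  (forall i, i != ord0 -> X 0 i = spherical t u theta phi 0 i * k) ->
  \det (\matrix_(i < 4) nth 0 [:: X;
    derive1 (fun s => spherical s u theta phi) t;
    derive1 (fun s => spherical t u s phi) theta;
    derive1 (fun s => spherical t u theta s) phi] i) =
  - (k * u ^+ 3 * sin theta).
Proof.
move=> XE; rewrite derive1_spherical_time derive1_spherical_theta derive1_spherical_phi.
rewrite det_time_row ?mxE //= !XE // !mxE /=.
have := cos2_sin2 theta; have := cos2_sin2 phi.
move: (sin theta) (cos theta) (sin phi) (cos phi) => a b d e H1 H2.
by ring: H1 H2.
Qed.

End tube.

(** * The constant factor of the flux: integrability and positivity *)

Section tube_weight.
Context {R : realType}.

Local Notation leb := (@lebesgue_measure R).
Local Notation mR := (measurableTypeR R).

Definition tube_domain : set (mR * mR * mR) :=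
  setT `*` `[0, pi] `*` `[0, 2 * pi].

Local Notation D := tube_domain.

Definition tube_weight (q : R * R * R) : R :=
  flat 0 (1 - q.1.1 ^+ 2) * sin q.1.2.

Lemma measurable_tube_domain : measurable D.
Proof. by apply: measurableX => //; apply: measurableX. Qed.

Let measurable_weight : measurable_fun D tube_weight.
Proof.
apply: measurable_funTS; apply: measurable_funM.
  apply: (measurableT_comp (f := fun s : R => flat 0 (1 - s ^+ 2))).
    apply: continuous_measurable_fun => s.
    apply: (@continuous_comp _ _ _ (fun s : R => 1 - s ^+ 2) (flat 0)).
      by apply: cvgB; [exact: cvg_cst|exact: exprn_continuous].
    exact: flat_continuous.
  exact: (measurableT_comp measurable_fst measurable_fst).
apply: (measurableT_comp (f := @sin R)).
  exact: continuous_measurable_fun (@continuous_sin R).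
exact: (measurableT_comp measurable_snd measurable_fst).
Qed.

Let weight_ge0 q : D q -> 0 <= tube_weight q.
Proof.
move=> [[_ /=]]; rewrite in_itv /= => q2 _.
by rewrite mulr_ge0 ?flat_ge0 // sin_ge0_pi.
Qed.

Let lebesgue3X (i j k : interval R) :
  lebesgue3 ([set` i] `*` [set` j] `*` [set` k]) =
  (leb [set` i] * leb [set` j] * leb [set` k])%E.
Proof.
have mij : measurable ([set` i] `*` [set` j] : set (mR * mR)) by exact: measurableX.
have mk : measurable ([set` k] : set mR) by [].
apply: (etrans (product_measure1E (@lebesgue_measure R \x @lebesgue_measure R)%E
  (@lebesgue_measure R) mij mk)).
by congr (_ * _)%E; exact: product_measure1E.
Qed.

(** The weight is at most 0! = 1 and vanishes for |t| >= 1, so the indicator of a box of finite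
    volume dominates it. *)
Lemma integrable_tube_weight : lebesgue3.-integrable D (EFin \o tube_weight).
Proof.
have mD := measurable_tube_domain.
apply/integrableP; split; first exact/measurable_EFinP.
pose box : set (mR * mR * mR) := `[-1, 1]%classic `*` `[0, pi] `*` `[0, 2 * pi].
have mbox : measurable box by apply: measurableX => //; apply: measurableX.
apply: (@le_lt_trans _ _ (\int[lebesgue3]_(q in D) (\1_box q)%:E)%E).
  apply: ge0_le_integral => //.
  - by apply: measurableT_comp => //; exact/measurable_EFinP.
  - by apply/measurable_EFinP; apply: measurable_funTS; exact: measurable_indic.
  - move=> [[t th] ph] [[_ /= th0] ph0]; rewrite lee_fin.
    have := weight_ge0 (q := (t, th, ph)) (conj (conj I th0) ph0).
    move=> w0; rewrite ger0_norm // /tube_weight /= indicE.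
    have [tin|tout] := boolP (t \in `[-1, 1]).
      rewrite mem_set //= -[leRHS]mulr1 ler_pM ?flat_ge0 ?sin_le1 //.
        by rewrite sin_ge0_pi // -in_itv.
      by rewrite (le_trans (flat_bounded _ _)) // fact0.
    rewrite flat_le0 ?mul0r ?ler0n //.
    rewrite subr_le0; apply/ltW; move: tout; rewrite in_itv /= negb_and -!ltNge.
    by case/orP => h; nra.
rewrite integral_indic // (le_lt_trans (measureIl _ _ _)) //.
suff : (lebesgue3 box < +oo)%E by [].
rewrite /box lebesgue3X !lebesgue_measure_itv /=.
by do !case: ifP => _; rewrite -?EFinB -?EFinM ?mule0 ?mul0e ?ltry.
Qed.

(** A zero integral would make the nonnegative weight vanish almost everywhere, yet it is positive
    on an open box of positive volume. *)
Lemma Rintegral_tube_weight_gt0 : 0 < Rintegral lebesgue3 D tube_weight.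
Proof.
have mD := measurable_tube_domain.
rewrite lt_def Rintegral_ge0 ?andbT //; apply/eqP => I0.
have Ie : (\int[lebesgue3]_(q in D) `|(tube_weight q)%:E| = 0)%E.
  have Hf := integrable_fin_num measurable_tube_domain integrable_tube_weight.
  transitivity (\int[lebesgue3]_(q in D) (tube_weight q)%:E)%E.
    apply: eq_integral => q; rewrite inE => Dq; rewrite gee0_abs // lee_fin.
    exact: weight_ge0.
  by rewrite -(fineK Hf) -[fine _]/(Rintegral lebesgue3 D tube_weight) I0.
have mW : measurable_fun D (EFin \o tube_weight) by exact/measurable_EFinP.
have [N [mN N0 sN]] := (ae_eq_integral_abs lebesgue3 measurable_tube_domain mW).1 Ie.
pose box : set (mR * mR * mR) := `]-1, 1[%classic `*` `]0, pi[ `*` `]0, 2 * pi[.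
have mbox : measurable box by apply: measurableX => //; apply: measurableX.
have boxN : box `<=` N.
  move=> [[t th] ph] [[/= t1 th1] ph1]; apply: sN => /=.
  move: t1 th1 ph1; rewrite !in_itv /= => /andP[t1 t2] th1 /andP[p1 p2] H.
  have /andP[th2 th3] := th1.
  have Dq : D (t, th, ph).
    by split; [split|] => //=; rewrite in_itv /= !ltW.
  move: (H Dq) => /eqP; rewrite eqe; apply/negP; rewrite gt_eqF //.
  rewrite /tube_weight /= mulr_gt0 ?sin_gt0_pi // flat_gt0 // subr_gt0.
  by nra.
have : (lebesgue3 box <= 0)%E by rewrite -N0 le_measure ?inE.
have pi0 := @pi_gt0 R.
have m11 : (-1 : R) < 1 by lra.
have pi2 : 0 < 2 * @pi R by lra.
rewrite /box lebesgue3X !lebesgue_measure_itv /= !lte_fin m11 pi0 pi2.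
by rewrite -!EFinB -!EFinM lee_fin leNgt !subr0 !mulr_gt0 //; lra.
Qed.

End tube_weight.

(** * Divergence of the flux *)

Section flux.
Context {R : realType} {G c M Q : R}.
Hypotheses (G_gt0 : 0 < G) (c_gt0 : 0 < c) (Q_neq0 : Q != 0)
  (superextremal : G * M ^+ 2 / Q ^+ 2 < 1).

Local Notation A := (mass_length G c M).
Local Notation B := (charge_length G c Q).
Local Notation r := (r_of_rho G c M Q).
Local Notation s := (r_exp_alpha G c M Q).
Local Notation rho0 := (inner_radius G c M Q).
Local Notation I0 := (Rintegral lebesgue3 tube_domain (@tube_weight R)).

Let rho0_gt0 : 0 < rho0.
Proof. exact: inner_radius_gt0. Qed.

Lemma time_space_bump_spherical (K t u theta phi : R) : 0 <= u ->
  time_space_bump K (spherical t u theta phi) =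
  flat 0 (1 - t ^+ 2) * flat 0 (K - u ^+ 2).
Proof.
move=> u0; rewrite /time_space_bump.
have := spatial_norm_sqr (spherical t u theta phi).
under eq_bigr do rewrite expr2.
by move=> ->; rewrite spatial_norm_spherical // mxE /= !mulN1r -expr2.
Qed.

(** The product of c s r^2 / u^3, the eigenvalue - B^2 / r^4 and the determinant factor - u^3 sin
    theta: the signs and the powers of u cancel. *)
Lemma flux_density_radial_bump (K t u theta phi : R) : rho0 < u ->
  interior_product (einstein_contract (rwn_metric G c M Q) (radial_bump K))
    (volume_form (rwn_metric G c M Q)) (spherical t u theta phi)
    (derive1 (fun s => spherical s u theta phi) t)
    (derive1 (fun s => spherical t u s phi) theta)
    (derive1 (fun s => spherical t u theta s) phi) =
  c * s u * B ^+ 2 / r u ^+ 2 * flat 0 (K - u ^+ 2) *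
  tube_weight (t, theta, phi).
Proof.
move=> hu; have u0 : 0 < u by exact: lt_trans hu.
have nE : spatial_norm (spherical t u theta phi) = u.
  by rewrite spatial_norm_spherical // ltW.
have hx : rho0 < spatial_norm (spherical t u theta phi) by rewrite nE.
rewrite /interior_product /volume_form.
rewrite (@det_spherical_tube _ _ _ _ _ _
  (- (time_space_bump K (spherical t u theta phi) * (B ^+ 2 / r u ^+ 4)))).
  rewrite volume_density_rwn // nE time_space_bump_spherical ?ltW //.
  rewrite /tube_weight /=.
  have [rp _] := r_of_rhoK G_gt0 c_gt0 Q_neq0 superextremal hu.
  have [rn un] : r u != 0 /\ u != 0 by rewrite !gt_eqF.
  by field; rewrite ?rn ?un.
move=> i i0.
rewrite (einstein_contract_rwn_radial G_gt0 c_gt0 Q_neq0 superextremal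
  (f := time_space_bump K (spherical t u theta phi)) hx) //.
  by rewrite nE mulrN -mulrA.
by move=> n; rewrite mxE.
Qed.

Lemma boundary_flux_radial_bump (K eps : R) : 0 < eps -> let u := rho0 + eps in
  boundary_flux (rwn_metric G c M Q) rho0 (radial_bump K) eps =
  c * s u * B ^+ 2 / r u ^+ 2 * flat 0 (K - u ^+ 2) * I0.
Proof.
move=> eps0 u; have hu : rho0 < u by rewrite ltrDl.
rewrite -(RintegralZl _ (measurable_tube_domain) (integrable_tube_weight)).
by apply: eq_Rintegral => -[[t theta] phi] _; exact: flux_density_radial_bump.
Qed.

(** By (B^2 - A^2) / (B - A) = B + A. *)
Lemma r_of_rho_inner_radius : r rho0 = 0.
Proof.
have n0 : B - A != 0 by rewrite gt_eqF.
by rewrite /r_of_rho /inner_radius; field.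
Qed.

Let rho0_neq0 : rho0 != 0. Proof. by rewrite gt_eqF. Qed.

Let inv_cvg : u^-1 @[u --> rho0] --> rho0^-1.
Proof. exact: inv_continuous. Qed.

Lemma boundary_flux_radial_bump_not_cvg (K l : R) : rho0 ^+ 2 < K ->
  ~ (boundary_flux (rwn_metric G c M Q) rho0 (radial_bump K) eps
     @[eps --> 0^'+] --> l).
Proof.
move=> hK Hl.
have shift : rho0 + eps @[eps --> 0^'+] --> rho0.
  rewrite -[X in _ --> X]addr0; apply: cvgD; first exact: cvg_cst.
  exact: cvg_at_right_filter cvg_id.
have r_cont : r u @[u --> rho0] --> r rho0.
  rewrite /r_of_rho; apply: cvgD; first exact: cvg_cst.
  apply: cvgMl; apply: cvgB; first exact: cvg_id.
  by apply: cvgMr; exact: inv_cvg.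
have s_cont : s u @[u --> rho0] --> s rho0.
  rewrite /r_exp_alpha; apply: cvgMl; apply: cvgD; first exact: cvg_id.
  by apply: cvgMr; exact: inv_cvg.
have flat_cont : flat 0 (K - u ^+ 2) @[u --> rho0] --> flat 0 (K - rho0 ^+ 2).
  apply: (@continuous_comp _ _ _ (fun v : R => K - v ^+ 2) (flat 0)).
    by apply: cvgB; [exact: cvg_cst|exact: exprn_continuous].
  exact: flat_continuous.
have r_cvg := cvg_comp _ _ shift r_cont.
rewrite r_of_rho_inner_radius in r_cvg.
have s_cvg := cvg_comp _ _ shift s_cont.
have flat_cvg := cvg_comp _ _ shift flat_cont.
(* r^2 times the flux *)
pose h eps := c * s (rho0 + eps) * B ^+ 2 * flat 0 (K - (rho0 + eps) ^+ 2) * I0.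
have h0 : h eps @[eps --> 0^'+] --> (0 : R).
  have H : r (rho0 + eps) * r (rho0 + eps) *
      boundary_flux (rwn_metric G c M Q) rho0 (radial_bump K) eps
      @[eps --> 0^'+] --> 0 * 0 * l.
    exact: cvgM (cvgM r_cvg r_cvg) Hl.
  rewrite !mul0r in H; apply: (cvg_trans _ H); apply: near_eq_cvg.
  (* The flux formula, and the division by r^2 in it, require eps > 0. *)
  have : \forall eps \near 0^'+, 0 < eps :> R by exact: nbhs_right_gt.
  apply: filterS => eps eps0.
  rewrite /= boundary_flux_radial_bump // /h.
  have hu : rho0 < rho0 + eps by rewrite ltrDl.
  have [rp _] := r_of_rhoK G_gt0 c_gt0 Q_neq0 superextremal hu.
  by field; rewrite gt_eqF.
have hl : h eps @[eps --> 0^'+] -->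
    c * s rho0 * B ^+ 2 * flat 0 (K - rho0 ^+ 2) * I0.
  apply: cvgMl; apply: cvgM flat_cvg; apply: cvgMl; exact: cvgMr.
have : 0 = c * s rho0 * B ^+ 2 * flat 0 (K - rho0 ^+ 2) * I0.
  exact: (cvg_unique (@norm_hausdorff _ R) h0 hl).
apply/eqP.
(* Every factor of the limit is positive: the cutoff because K exceeds rho_0^2, and s because rho_0
   and B^2 - A^2 are positive. *)
rewrite eq_sym gt_eqF // mulr_gt0 ?Rintegral_tube_weight_gt0 //.
have AB := superextremal_lengths G_gt0 c_gt0 Q_neq0 superextremal.
have B0 : 0 < B by exact: le_lt_trans (normr_ge0 _) AB.
rewrite mulr_gt0 ?flat_gt0 ?subr_gt0 // mulr_gt0 ?exprn_gt0 // mulr_gt0 //.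
move: AB; rewrite ltr_norml => /andP[AB1 AB2].
rewrite /r_exp_alpha divr_gt0 // addr_gt0 // divr_gt0 //; nra.
Qed.

End flux.

Theorem mainTheorem3 (R : realType) (G c M Q : R)
    (G_gt0 : 0 < G) (c_gt0 : 0 < c) (Q_neq0 : Q != 0)
    (superextremal : G * M ^+ 2 / Q ^+ 2 < 1) :
  ~ bianchi_weakly (rwn_metric G c M Q) (inner_radius G c M Q) /\
  ~ inhomogeneous_bianchi_weakly
      (rwn_metric G c M Q) (inner_radius G c M Q).
Proof.
suff H : ~ inhomogeneous_bianchi_weakly (rwn_metric G c M Q) (inner_radius G c M Q).
  by split=> // -[].
(* Any K above rho_0^2 keeps the cutoff positive on the boundary sphere. *)
pose K := inner_radius G c M Q ^+ 2 + 1.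
have K0 : 0 <= K by rewrite addr_ge0 ?sqr_ge0.
move=> /(_ _ (radial_bump_smooth_compactly_supported _ K0)) [_].
apply: boundary_flux_radial_bump_not_cvg => //.
by rewrite /K ltrDl.
Qed.
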